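(* Let $K\ge 1$ be an integer, $\mathcal{K}=\{0,\pm1,\dots,\pm K\}$, fix $i\in\mathcal{K}$, and let $L,h,d,\eta,P_t,\sigma^2,\gamma_0>0$. Fix a reference user location $(x_u^i,y_u^i,0)$ with $x_u^i\in[-L/2,L/2]$ and $y_u^i\in[id-d/2,\,id+d/2]$. Let $\{x_u^k\}_{k\in\mathcal{K}\setminus\{i\}}$ be independent random variables, each uniformly distributed on $[-L/2,L/2]$. Define $$\hat r_0=(id-y_u^i)^2+h^2,\qquad \hat r_k=(x_u^k-x_u^i)^2+(kd-y_u^i)^2+h^2\ \ (k\in\mathcal{K}\setminus\{i\}),$$ and the SINR $$\gamma_u^i=\frac{\hat r_0^{-1}}{\eta\sum_{k\in\mathcal{K}\setminus\{i\}}\hat r_k^{-1}+\frac{\sigma^2}{P_t}}.$$ Let $\mathcal{P}_s=\mathbb{P}(\gamma_u^i>\gamma_0)$ and $$A=\frac{\sigma^2}{\eta P_t}+\sum_{k\in\mathcal{K}\setminus\{i\}}\hat r_k^{-1}-\frac{\hat r_0^{-1}}{\eta\gamma_0}$$ (viewed as a function of the $2K$ variables $x_u^k$, $k\in\mathcal{K}\setminus\{i\}$). Then $$\mathcal{P}_s=\frac12-\frac1\pi\left(\frac1L\right)^{2K}\int_0^\infty \mathrm{Im}\left(\int_{-L/2}^{L/2}\!\!\cdots\int_{-L/2}^{L/2} e^{jtA}\prod_{k\in\mathcal{K}\setminus\{i\}}\mathrm{d}x_u^k\right)\frac{\mathrm{d}t}{t},$$ where the inner integral is a $2K$-fold integral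 over all $x_u^k$, $k\in\mathcal{K}\setminus\{i\}$, $j$ is the imaginary unit and $\mathrm{Im}$ denotes the imaginary part.
   Context: Setting (pinching-antenna system in a room): $2K+1$ waveguides lie on the ceiling at height $h$ along the lines $y=kd$, $z=h$, $k\in\mathcal{K}$, each of length $L$ (so $x\in[-L/2,L/2]$). Waveguide $k$ carries one pinching antenna placed directly above its served user $u_k$, i.e. at $(x_u^k,kd,h)$, where the users' $x$-coordinates are uniformly distributed along the room length independently of each other. The reference user $u_i$ is at $(x_u^i,y_u^i,0)$ and is served by the antenna at $(x_u^i,id,h)$; the other antennas act as interferers. $\eta$ is the reference path-loss constant, $P_t$ the per-antenna transmit power, $\sigma^2$ the noise variance, $\gamma_0$ the SINR threshold. The SINR used by the paper is exactly the expression $\gamma_u^i$ given in the claim, and $\mathcal{P}_s$ is called the successful transmission probability. *)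

(* Defs.v *)
From HB Require Import structures.
From mathcomp Require Import all_boot all_order all_algebra.
From mathcomp Require Import all_classical all_reals all_analysis.
From mathcomp Require complex.
Set Implicit Arguments. Unset Strict Implicit. Unset Printing Implicit Defensive.
Import Order.TTheory GRing.Theory Num.Theory.
Local Open Scope classical_set_scope.
Local Open Scope ring_scope.

Section PinchDefs.
Variable R : realType.
Local Notation mu := (@lebesgue_measure R).

Definition idxK (K : nat) : seq int :=
  [seq (n%:Z - K%:Z) | n <- iota 0 (2 * K).+1].
Definition idxKi (K : nat) (i : int) : seq int :=
  [seq k <- idxK K | k != i].

Definition mutually_independent d (T : measurableType d) (P : probability T R)
    (s : seq int) (X : int -> T -> R) : Prop :=
  forall (s' : seq int), uniq s' -> {subset s' <= s} ->
  forall (B : int -> set R), (forall k, measurable (B k)) ->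
    P (\bigcap_(k in [set k | k \in s']) (X k @^-1` B k)) =
    (\prod_(k <- s') P (X k @^-1` B k))%E.

Definition uniform_on d (T : measurableType d) (P : probability T R)
    (a b : R) (Y : T -> R) : Prop :=
  measurable_fun setT Y /\
  forall B : set R, measurable B ->
    P (Y @^-1` B) = (mu (B `&` `[a, b]) * ((b - a)^-1)%:E)%E.

(* Iterated integral over the box [a,b]^s of f : (int -> R) -> R, integrating
   the coordinates listed in s one after the other (Lebesgue integrals);
   x supplies the values of the coordinates not (yet) integrated. *)
Fixpoint iint (a b : R) (s : seq int) (f : (int -> R) -> R) (x : int -> R) : R :=
  match s with
  | [::] => f x
  | k :: s' => fine (\int[mu]_(t in `[a, b]) (iint a b s' f
                        (fun m => if m == k then t else x m))%:E)%E
  end.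

Definition ciint (a b : R) (s : seq int) (f : (int -> R) -> complex.complex R)
    (x : int -> R) : complex.complex R :=
  complex.Complex (iint a b s (fun y => complex.Re (f y)) x)
                  (iint a b s (fun y => complex.Im (f y)) x).

Definition expj (th : R) : complex.complex R := complex.Complex (cos th) (sin th).

Definition r0 (d h : R) (i : int) (yi : R) : R := (i%:~R * d - yi) ^+ 2 + h ^+ 2.
Definition rk (d h : R) (xi yi : R) (x : int -> R) (k : int) : R :=
  (x k - xi) ^+ 2 + (k%:~R * d - yi) ^+ 2 + h ^+ 2.

Definition sinr (K : nat) (i : int) (d h eta Pt sigma2 xi yi : R) (x : int -> R) : R :=
  (r0 d h i yi)^-1 /
  (eta * \sum_(k <- idxKi K i) (rk d h xi yi x k)^-1 + sigma2 / Pt).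

Definition Aq (K : nat) (i : int) (d h eta Pt sigma2 gamma0 xi yi : R)
    (x : int -> R) : R :=
  sigma2 / (eta * Pt) + \sum_(k <- idxKi K i) (rk d h xi yi x k)^-1
  - (r0 d h i yi)^-1 / (eta * gamma0).

End PinchDefs.

(* Main.v *)
Require Import Defs.
From HB Require Import structures.
From mathcomp Require Import all_boot all_order all_algebra.
From mathcomp Require Import all_classical all_reals all_analysis.
From mathcomp Require complex.
From mathcomp Require Import zify ring lra measurable_realfun.
Import Order.TTheory GRing.Theory Num.Theory numFieldNormedType.Exports.
Local Open Scope classical_set_scope.
Local Open Scope ring_scope.

(** Write [Z] for the random variable obtained by evaluating [A] at the positions
    of the interferers, so that the transmission succeeds iff [Z < 0].  Since [Z] is a
    constant plus a sum of independent terms, [exp (j t Z)] factors both under the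
    expectation and under the iterated Lebesgue integral; comparing the two
    factorisations identifies the box integral of [sin (t A)] with
    [L ^ (2 K) * E (sin (t Z))], and no joint law of all the positions is needed.
    What remains is the Gil-Pelaez inversion formula.  By Fubini, the integral of
    [E (sin (t Z)) / t] up to [tau] is the expectation of the integral of
    [sin (t Z) / t], which is bounded uniformly in [tau] and tends to
    [sgn Z * pi / 2]; dominated convergence then yields
    [P (Z < 0) - P (Z > 0)], up to a factor.  The event [Z = 0] is null because the
    level sets of [x |-> 1 / ((x - xi)^2 + q)] are finite and each position has an
    absolutely continuous law independent of the others. *)

(** * Measurability and Fubini's theorem *)

(** Inversion is continuous off 0 and every function is measurable on a singleton, so the line is
    cut at 0. *)
Lemma measurable_invr (R : realType) : measurable_fun setT (@GRing.inv R).
Proof.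
rewrite -(setUv [set (0 : R)]); apply/measurable_funU => //; first exact: measurableC.
split; last first.
  apply: open_continuous_measurable_fun.
    by apply: closed_openC; exact: closed_eq.
  by move=> x; rewrite inE => /= x0; apply: inv_continuous; apply/eqP.
exact: measurable_fun_set1.
Qed.

Lemma measurable_cos_comp d (T : measurableType d) (R : realType) (f : T -> R) :
  measurable_fun setT f -> measurable_fun setT (fun x => cos (f x)).
Proof.
move=> mf; apply: measurableT_comp mf.
by apply: continuous_measurable_fun; exact: continuous_cos.
Qed.

Lemma measurable_sin_comp d (T : measurableType d) (R : realType) (f : T -> R) :
  measurable_fun setT f -> measurable_fun setT (fun x => sin (f x)).
Proof.
move=> mf; apply: measurableT_comp mf.
by apply: continuous_measurable_fun; exact: continuous_sin.
Qed.

Lemma integrable_bounded d (T : measurableType d) (R : realType)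
    (mu : {measure set T -> \bar R}) (D : set T) (f : T -> R) (M : R) :
  measurable D -> (mu D < +oo)%E -> measurable_fun D f ->
  (forall x, D x -> `|f x| <= M) -> mu.-integrable D (EFin \o f).
Proof.
move=> mD Dfin mf fM; apply: measurable_bounded_integrable => //.
exists M; split; first exact: num_real.
by move=> y My x Dx; exact: le_trans (fM x Dx) (ltW My).
Qed.

Lemma integrable_bounded_probability d (T : measurableType d) (R : realType)
    (P : probability T R) (f : T -> R) (M : R) :
  measurable_fun setT f -> (forall x, `|f x| <= M) ->
  P.-integrable setT (EFin \o f).
Proof.
move=> mf fM; apply: (@integrable_bounded _ _ _ _ _ _ M) => //.
by rewrite (le_lt_trans (probability_le1 _ _)) ?ltry.
Qed.

Section fubini_in.
Local Open Scope ereal_scope.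
Context d1 d2 (T1 : measurableType d1) (T2 : measurableType d2) (R : realType).
Variable m1 : {sigma_finite_measure set T1 -> \bar R}.
Variable m2 : {sigma_finite_measure set T2 -> \bar R}.
Variables (D1 : set T1) (D2 : set T2).

(** Extending the integrand by 0 off the rectangle reduces Fubini on [D1] and [D2] to Fubini on the
    whole spaces. *)
Lemma iterated_integral_mkcond (h : T1 * T2 -> \bar R) :
  \int[m1]_(x in D1) \int[m2]_(y in D2) h (x, y) =
  \int[m1]_x \int[m2]_y (h \_ (D1 `*` D2)) (x, y).
Proof.
rewrite integral_mkcond; apply: eq_integral => x _; rewrite patchE.
case: ifPn => xD1.
  rewrite integral_mkcond; apply: eq_integral => y _; rewrite !patchE.
  by rewrite in_setX xD1.
by rewrite integral0_eq// => y _; rewrite patchE in_setX (negbTE xD1).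
Qed.

Lemma iterated_integral_mkcond_swap (h : T1 * T2 -> \bar R) :
  \int[m2]_(y in D2) \int[m1]_(x in D1) h (x, y) =
  \int[m2]_y \int[m1]_x (h \_ (D1 `*` D2)) (x, y).
Proof.
rewrite integral_mkcond; apply: eq_integral => y _; rewrite patchE.
case: ifPn => yD2.
  rewrite integral_mkcond; apply: eq_integral => x _; rewrite !patchE.
  by rewrite in_setX yD2 andbT.
by rewrite integral0_eq// => x _; rewrite patchE in_setX (negbTE yD2) andbF.
Qed.

(** By Tonelli a finite iterated integral of the absolute value is enough, so a domain of infinite
    measure such as [[0, +oo[] is allowed. *)
Lemma Fubini_in (f : T1 * T2 -> R) : measurable D1 -> measurable D2 ->
  measurable_fun setT f ->
  \int[m1]_(x in D1) \int[m2]_(y in D2) `|f (x, y)|%:E < +oo ->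
  \int[m1]_(x in D1) \int[m2]_(y in D2) (f (x, y))%:E =
  \int[m2]_(y in D2) \int[m1]_(x in D1) (f (x, y))%:E.
Proof.
move=> mD1 mD2 mf fi.
rewrite (iterated_integral_mkcond (EFin \o f)).
rewrite (iterated_integral_mkcond_swap (EFin \o f)).
apply: Fubini; apply/integrable12ltyP.
  apply/(measurable_restrict _ (measurableX mD1 mD2) measurableT).
  by rewrite setTI; apply/measurable_EFinP/measurable_funTS.
move: fi; rewrite (iterated_integral_mkcond (fun z => `|f z|%:E)).
congr (_ < _); apply: eq_integral => x _; apply: eq_integral => y _.
by rewrite !patchE; case: ifPn => //=; rewrite normr0.
Qed.

Lemma integrable_patch_bounded (f : T1 * T2 -> R) (M : R) :
  measurable D1 -> measurable D2 -> m1 D1 < +oo -> m2 D2 < +oo ->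
  measurable_fun setT f -> (forall z, (`|f z| <= M)%R) ->
  (m1 \x m2).-integrable setT ((EFin \o f) \_ (D1 `*` D2)).
Proof.
move=> mD1 mD2 D1fin D2fin mf fM.
have mD := measurableX mD1 mD2.
apply/(integrable_mkcond _ mD); apply: (@integrable_bounded _ _ _ _ _ _ M) => //.
- have /= -> := product_measure1E m1 m2 mD1 mD2.
  by rewrite lte_mul_pinfty// ge0_fin_numE.
- exact: measurable_funTS.
Qed.

Lemma Fubini_bounded (f : T1 * T2 -> R) (M : R) :
  measurable D1 -> measurable D2 -> m1 D1 < +oo -> m2 D2 < +oo ->
  measurable_fun setT f -> (forall z, (`|f z| <= M)%R) ->
  \int[m1]_(x in D1) \int[m2]_(y in D2) (f (x, y))%:E =
  \int[m2]_(y in D2) \int[m1]_(x in D1) (f (x, y))%:E.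
Proof.
move=> mD1 mD2 D1fin D2fin mf fM.
rewrite (iterated_integral_mkcond (EFin \o f)).
rewrite (iterated_integral_mkcond_swap (EFin \o f)).
by apply: Fubini; exact: integrable_patch_bounded fM.
Qed.

Lemma integrable_integral_bounded (f : T1 * T2 -> R) (M : R) :
  measurable D1 -> measurable D2 -> m1 D1 < +oo -> m2 D2 < +oo ->
  measurable_fun setT f -> (forall z, (`|f z| <= M)%R) ->
  m1.-integrable D1 (fun x => \int[m2]_(y in D2) (f (x, y))%:E).
Proof.
move=> mD1 mD2 D1fin D2fin mf fM; apply/(integrable_mkcond _ mD1).
have := integrable_fubini_F (integrable_patch_bounded f M mD1 mD2 D1fin D2fin mf fM).
apply: eq_integrable => // x _; rewrite /fubini_F patchE; case: ifPn => xD1.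
  rewrite [RHS]integral_mkcond; apply: eq_integral => y _.
  by rewrite !patchE in_setX xD1.
by rewrite integral0_eq// => y _; rewrite patchE in_setX (negbTE xD1).
Qed.

End fubini_in.

(** * The Dirichlet integral *)

Lemma FTC2_is_derive (R : realType) (f F : R -> R) (a b : R) : a < b ->
  continuous f -> (forall x : R, is_derive x 1 F (f x)) ->
  (\int[@lebesgue_measure R]_(x in `[a, b]) (f x)%:E = (F b - F a)%:E)%E.
Proof.
move=> ab cf dF.
have cF : continuous F.
  by move=> x; apply: differentiable_continuous; apply/derivable1_diffP; apply: ex_derive.
rewrite EFinB; apply: continuous_FTC2 => //.
- exact: continuous_subspaceT.
- split.
  + by move=> x _; apply: ex_derive.
  + exact/cvg_at_right_filter/cF.
  + exact/cvg_at_left_filter/cF.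
- by move=> x _; rewrite derive1E; exact: derive_val.
Qed.

Lemma is_derive_scale (R : realType) (f : R -> R) (c x df : R) :
  is_derive (c * x : R) 1 f df -> is_derive x 1 (fun y => f (c * y)) (c * df).
Proof.
move=> df1.
have h : is_derive x 1 (fun y : R => c * y) c.
  by apply: is_derive_eq; rewrite scaler1.
by rewrite (mulrC c df); exact: is_derive1_comp df1 h.
Qed.

Lemma integral_sin_exp (R : realType) (a u tau : R) : 0 < tau ->
  (\int[@lebesgue_measure R]_(t in `[0%R, tau])
     (a * sin (a * t) * expR (- (u * a) * t))%:E =
   ((1 - expR (- (u * a) * tau) * (cos (a * tau) + u * sin (a * tau)))
      / (1 + u ^+ 2))%:E)%E.
Proof.
move=> t0.
have u0 : 1 + u ^+ 2 != 0 by rewrite lt0r_neq0// ltr_wpDr// sqr_ge0.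
(* This primitive comes from integrating by parts twice. Taking the decay rate to be [u * a] makes
   the denominator [1 + u ^+ 2] independent of [a]. *)
pose F t : R := - (expR (- (u * a) * t) * (cos (a * t) + u * sin (a * t))) / (1 + u ^+ 2).
have dF (x : R) : is_derive x 1 F (a * sin (a * x) * expR (- (u * a) * x)).
  have d1 := is_derive_scale _ _ (- (u * a)) x _ (is_derive_expR (- (u * a) * x)).
  have d2 := is_derive_scale _ _ a x _ (is_derive_cos (a * x)).
  have d3 := is_derive_scale _ _ a x _ (is_derive_sin (a * x)).
  rewrite /F; apply: is_derive_eq.
  by rewrite /GRing.scale /=; field.
rewrite (FTC2_is_derive _ _ _ _ _ t0 _ dF).
  by rewrite /F !mulr0 expR0 cos0 sin0 mulr0 addr0 mulr1; congr EFin; field.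
move=> x; apply: cvgM.
  apply: cvgM; first exact: cvg_cst.
  by apply: continuous_comp; [exact: mulrl_continuous|exact: continuous_sin].
by apply: continuous_comp; [exact: mulrl_continuous|exact: continuous_expR].
Qed.

(** This is the total mass of the exponential density. *)
Lemma integral_exp0y (R : realType) (r : R) : 0 < r ->
  (\int[@lebesgue_measure R]_(u in `[0%R, +oo[) (r * expR (- r * u))%:E = 1)%E.
Proof.
move=> r0; rewrite -(integral_exponential_pdf r0) [RHS]integral_mkcond/=.
rewrite [LHS]integral_mkcond/=.
apply: eq_integral => x _; rewrite !patchE in_setT; case: ifPn => // xr.
  by rewrite exponential_pdfE//; move: xr; rewrite inE/= in_itv/= andbT.
by rewrite /exponential_pdf patchE (negbTE xr).
Qed.

(** Mean value theorem between 0 and [x]; oddness covers negative [x]. *)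
Lemma normr_sin_le (R : realType) (x : R) : `|sin x| <= `|x|.
Proof.
wlog x0 : x / 0 < x.
  move=> H; have [x0|x0|->] := ltrgt0P x; last by rewrite sin0 normr0.
    by rewrite -{2}(gtr0_norm x0) H.
  by rewrite -normrN -sinN (le_trans (H (- x) _)) ?oppr_gt0// normrN ltr0_norm.
have [|c _] := @MVT R sin cos 0 x x0.
  by apply: continuous_subspaceT; exact: continuous_sin.
by rewrite sin0 !subr0 => ->; rewrite normrM ler_piMl// cos_max.
Qed.

Lemma integrable_expR0y (R : realType) (c r : R) : 0 < r ->
  (@lebesgue_measure R).-integrable `[0%R, +oo[ (fun u => (c * expR (- r * u))%:E).
Proof.
move=> r0.
have -> : (fun u => (c * expR (- r * u))%:E) =
    (fun u => (c / r)%:E * (r * expR (- r * u))%:E)%E.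
  by apply/funext => u; rewrite -EFinM; congr EFin; field; rewrite gt_eqF.
apply: integrableZl => //; apply/integrableP; split.
  apply/measurable_EFinP; apply: measurable_funTS; apply: measurable_funM => //.
  by apply: measurableT_comp => //; exact: measurable_funM.
under eq_integral do rewrite gee0_abs ?lee_fin ?mulr_ge0 ?expR_ge0 ?(ltW r0)//.
by rewrite integral_exp0y// ltry.
Qed.

Lemma integral_expR0y (R : realType) (c r : R) : 0 < r ->
  (\int[@lebesgue_measure R]_(u in `[0%R, +oo[) (c * expR (- r * u))%:E =
   (c / r)%:E)%E.
Proof.
move=> r0.
transitivity ((c / r)%:E * \int[@lebesgue_measure R]_(u in `[0%R, +oo[)
    (r * expR (- r * u))%:E)%E; last by rewrite integral_exp0y// mule1.
rewrite -integralZl//; last exact: integrable_expR0y.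
by apply: eq_integral => u _; rewrite -EFinM; congr EFin; field; rewrite gt_eqF.
Qed.

(* Fubini for [a sin(a t) exp(- u a t)] over [0 <= t <= tau] and [0 <= u]: the
   integral in [u] is [sin(a t) / t], also at [t = 0], where it vanishes and
   [sin(a t) / t] has the junk value [0]. *)
Lemma integral_sin_div (R : realType) (a tau : R) : 0 < a -> 0 < tau ->
  (\int[@lebesgue_measure R]_(t in `[0%R, tau]) (sin (a * t) / t)%:E =
   \int[@lebesgue_measure R]_(u in `[0%R, +oo[)
     ((1 - expR (- (a * tau) * u) * (cos (a * tau) + u * sin (a * tau)))
      / (1 + u ^+ 2))%:E)%E.
Proof.
move=> a0 t0.
pose f (z : R * R) : R := a * sin (a * z.1) * expR (- (z.2 * a) * z.1).
have mf : measurable_fun setT f.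
  apply: measurable_funM.
    apply: measurable_funM; first exact: measurable_cst.
    apply: measurable_sin_comp.
    by apply: measurable_funM; [exact: measurable_cst|exact: measurable_fst].
  apply: measurableT_comp; first exact: measurable_expR.
  apply: measurable_funM; last exact: measurable_fst.
  apply: measurableT_comp; first exact: oppr_measurable.
  by apply: measurable_funM; [exact: measurable_snd|exact: measurable_cst].
(* [c] is kept abstract because the identity serves twice: with [sin (a * t)], and with its absolute
   value when Fubini is justified. *)
have inner t (c : R) : 0 <= t -> (t = 0 -> c = 0) ->
    (\int[@lebesgue_measure R]_(u in `[0%R, +oo[) (a * c * expR (- (u * a) * t))%:E =
    (c / t)%:E)%E.
  rewrite le_eqVlt => /predU1P[<- /(_ erefl) ->|t1 _].
    by rewrite mul0r integral0_eq// => u _; rewrite mulr0 mul0r.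
  transitivity (\int[@lebesgue_measure R]_(u in `[0%R, +oo[)
      (a * c * expR (- (a * t) * u))%:E)%E.
    by apply: eq_integral => u _; congr (_ * expR _)%:E; ring.
  rewrite integral_expR0y ?mulr_gt0//; congr EFin; field.
  by rewrite !gt_eqF.
transitivity (\int[@lebesgue_measure R]_(t in `[0%R, tau])
  \int[@lebesgue_measure R]_(u in `[0%R, +oo[) (f (t, u))%:E)%E.
  apply: eq_integral => t; rewrite inE/= in_itv/= => /andP[t1 _].
  by rewrite /f/= inner// => ->; rewrite mulr0 sin0.
rewrite Fubini_in//.
- apply: eq_integral => u _; rewrite /f/=.
  rewrite integral_sin_exp//.
  by congr ((1 - expR _ * _) / _)%:E; ring.
(* Absolute convergence: integrating in [u] first leaves [|sin (a * t)| / t], which is at most [a]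
   on a bounded interval. *)
- rewrite (@le_lt_trans _ _ (\int[@lebesgue_measure R]_(t in `[0%R, tau]) a%:E)%E)//; last first.
    by rewrite integral_cst//= lebesgue_measure_itv/= lte_fin t0 oppr0 adde0 -EFinM ltry.
  have -> : (\int[@lebesgue_measure R]_(t in `[0%R, tau])
      \int[@lebesgue_measure R]_(u in `[0%R, +oo[) `|f (t, u)|%:E =
      \int[@lebesgue_measure R]_(t in `[0%R, tau]) (`|sin (a * t)| / t)%:E)%E.
    apply: eq_integral => t; rewrite inE/= in_itv/= => /andP[t1 _].
    rewrite -inner//; last by move=> ->; rewrite mulr0 sin0 normr0.
    apply: eq_integral => u _; rewrite /f/= !normrM (gtr0_norm a0).
    by rewrite (ger0_norm (expR_ge0 _)).
  apply: ge0_le_integral => //=.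
  + move=> t; rewrite in_itv/= => /andP[t1 _].
    by rewrite lee_fin divr_ge0.
  + apply/measurable_EFinP; apply: measurable_funTS; apply: measurable_funM => //.
      by apply: measurableT_comp => //; apply: measurable_sin_comp; exact: measurable_funM.
    exact: measurable_invr.
  + move=> t; rewrite in_itv/= => /andP[+ _]; rewrite le_eqVlt => /predU1P[<-|t1].
      by rewrite invr0 mulr0 lee_fin ltW.
    rewrite lee_fin ler_pdivrMr// (le_trans (normr_sin_le _ _))//.
    by rewrite ger0_norm// mulr_ge0// ltW.
Qed.

(** In the integral over [u], the term [1 / (1 + u ^+ 2)] contributes exactly [pi / 2]. The rest is
    at most [2 * expR (- X * u)] in absolute value, where [X = a * tau], since [|cos X + u * sin X|
    <= 1 + u <= 2 * (1 + u ^+ 2)]; this integrates to [2 / X]. *)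
Lemma Rintegral_sin_div_pihalf (R : realType) (a tau : R) : 0 < a -> 0 < tau ->
  `| \int[@lebesgue_measure R]_(t in `[0%R, tau]) (sin (a * t) / t) - pi / 2 |
    <= 2 / (a * tau).
Proof.
move=> a0 t0; rewrite /Rintegral integral_sin_div//.
set X := a * tau; have X0 : 0 < X by exact: mulr_gt0.
rewrite -[fine _]/(\int[@lebesgue_measure R]_(u in `[0%R, +oo[)
  ((1 - expR (- X * u) * (cos X + u * sin X)) / (1 + u ^+ 2))).
pose g u := expR (- X * u) * (cos X + u * sin X) / (1 + u ^+ 2).
have gle u : 0 <= u -> `|g u| <= 2 * expR (- X * u).
  move=> u0; rewrite /g !normrM (ger0_norm (expR_ge0 _)) -mulrA (mulrC 2).
  rewrite ler_wpM2l ?expR_ge0//.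
  have u2 : 0 < 1 + u ^+ 2 by rewrite ltr_wpDr// sqr_ge0.
  rewrite normfV (gtr0_norm u2) ler_pdivrMr//.
  rewrite (le_trans (ler_normD _ _))// normrM (ger0_norm u0).
  have := cos_max X; have := sin_max X.
  have : u * `|sin X| <= u by rewrite ler_piMr// sin_max.
  by nra.
have mg : measurable_fun setT g.
  apply: measurable_funM; last first.
    apply: measurableT_comp; first exact: measurable_invr.
    by apply: measurable_funD => //; exact: measurable_funX.
  apply: measurable_funM; last first.
    by apply: measurable_funD => //; exact: measurable_funM.
  by apply: measurableT_comp => //; exact: measurable_funM.
have ig : (@lebesgue_measure R).-integrable `[0%R, +oo[ (EFin \o g).
  apply: (le_integrable _ _ _ (integrable_expR0y _ 2 _ X0)) => //.
    exact/measurable_EFinP/measurable_funTS.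
  move=> u; rewrite /= in_itv/= andbT => u0; rewrite lee_fin.
  by rewrite [leRHS]ger0_norm ?gle// mulr_ge0// expR_ge0.
have i1 : (@lebesgue_measure R).-integrable `[0%R, +oo[ (EFin \o (fun u => (oneDsqr u)^-1)).
  apply/integrableP; split.
    apply/measurable_EFinP; apply: measurable_funTS.
    by apply: continuous_measurable_fun; exact: continuous_oneDsqrV.
  under eq_integral do rewrite gee0_abs ?lee_fin ?invr_ge0//.
  by rewrite integral0y_oneDsqr ltry.
have -> : \int[@lebesgue_measure R]_(u in `[0%R, +oo[)
    ((1 - expR (- X * u) * (cos X + u * sin X)) / (1 + u ^+ 2)) =
    \int[@lebesgue_measure R]_(u in `[0%R, +oo[) ((oneDsqr u)^-1 - g u).
  by apply: eq_Rintegral => u _; rewrite /g /oneDsqr mulrBl div1r.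
rewrite RintegralB// {1}/Rintegral integral0y_oneDsqr/= addrAC subrr add0r normrN.
rewrite (le_trans (le_normr_Rintegral _ ig))//.
apply: (@le_trans _ _ (\int[@lebesgue_measure R]_(u in `[0%R, +oo[) (2 * expR (- X * u)))).
  apply: le_Rintegral => //.
  - exact: integrable_abse ig.
  - exact: integrable_expR0y.
  - by move=> u; rewrite /= in_itv/= andbT; exact: gle.
by rewrite /Rintegral integral_expR0y.
Qed.

(** At [t = 0] the quotient is 0 by the convention [0^-1 = 0], so the bound is valid for every
    [t]. *)
Lemma normr_sin_div_le (R : realType) (a t : R) : `|sin (a * t) / t| <= `|a|.
Proof.
have [->|t1] := eqVneq t 0; first by rewrite invr0 mulr0 normr0.
by rewrite normrM normfV ler_pdivrMr ?normr_gt0// -normrM normr_sin_le.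
Qed.

Lemma lebesgue_measure_itvcc_fin (R : realType) (a b : R) :
  (@lebesgue_measure R `[a, b] < +oo)%E.
Proof. by rewrite lebesgue_measure_itv/=; case: ifPn => _; rewrite -?EFinB ltry. Qed.

Lemma integrable_sin_div (R : realType) (a tau : R) :
  (@lebesgue_measure R).-integrable `[0%R, tau] (EFin \o (fun t => sin (a * t) / t)).
Proof.
apply: (@integrable_bounded _ _ _ _ _ _ `|a|) => //.
- exact: lebesgue_measure_itvcc_fin.
- apply: measurable_funTS; apply: measurable_funM; last exact: measurable_invr.
  by apply: measurable_sin_comp; exact: measurable_funM.
- by move=> t _; exact: normr_sin_div_le.
Qed.

Lemma Rintegral_sin_div_small (R : realType) (a tau : R) : 0 <= tau ->
  `| \int[@lebesgue_measure R]_(t in `[0%R, tau]) (sin (a * t) / t) | <= `|a| * tau.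
Proof.
move=> t0.
have i := integrable_sin_div _ a tau.
rewrite (le_trans (le_normr_Rintegral _ i))//.
apply: (@le_trans _ _ (\int[@lebesgue_measure R]_(t in `[0%R, tau]) `|a|)).
  apply: le_Rintegral => //; first exact: integrable_abse i.
  apply: (@integrable_bounded _ _ _ _ _ _ `|a|) => //.
    exact: lebesgue_measure_itvcc_fin.
  by move=> t _; rewrite normr_id.
  by move=> t _; exact: normr_sin_div_le.
have E : @lebesgue_measure R `[0%R, tau] = tau%:E.
  rewrite lebesgue_measure_itv/= lte_fin; case: ltP => [_|t1]; first by rewrite oppr0 adde0.
  by congr EFin; apply/eqP; rewrite eq_le t0.
by rewrite Rintegral_cst//= E.
Qed.

Lemma Rintegral_sin_divN (R : realType) (a tau : R) :
  \int[@lebesgue_measure R]_(t in `[0%R, tau]) (sin (- a * t) / t) =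
  - \int[@lebesgue_measure R]_(t in `[0%R, tau]) (sin (a * t) / t).
Proof.
rewrite -[RHS]mulN1r -RintegralZl//; last exact: integrable_sin_div.
by apply: eq_Rintegral => t _; rewrite mulNr sinN mulNr mulN1r.
Qed.

(** A bound uniform in both [a] and [tau] is what dominated convergence requires. If [a * tau <= 1]
    the crude bound [a * tau] suffices; otherwise the integral lies within 2 of [pi / 2 < 2]. *)
Lemma Rintegral_sin_div_bounded (R : realType) (a tau : R) :
  `| \int[@lebesgue_measure R]_(t in `[0%R, tau]) (sin (a * t) / t) | <= 5.
Proof.
have [tau0|t0] := ltP tau 0.
  by rewrite set_itv_ge -?ltNge// Rintegral_set0 normr0.
wlog a0 : a / 0 < a.
  move=> H; have [a0|a0|->] := ltrgt0P a; first exact: H.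
    by rewrite -(opprK a) Rintegral_sin_divN normrN H// oppr_gt0.
  by rewrite (le_trans (Rintegral_sin_div_small _ _ _ t0))// normr0 mul0r.
have [le1|gt1] := leP (a * tau) 1.
  by rewrite (le_trans (Rintegral_sin_div_small _ _ _ t0))// (gtr0_norm a0); lra.
have t1 : 0 < tau.
  rewrite lt_neqAle t0 andbT; apply/eqP => tE.
  by move: gt1; rewrite -tE mulr0; lra.
have := Rintegral_sin_div_pihalf _ _ _ a0 t1.
have : 2 / (a * tau) <= 2 by rewrite ler_pdivrMr ?mulr_gt0//; lra.
have := pihalf_ge1 R; have := pihalf_lt2 R.
set I := Rintegral _ _ _; rewrite !ler_norml => ? ? ? /andP[? ?].
by apply/andP; split; lra.
Qed.

Lemma cvg_Rintegral_sin_div (R : realType) (a : R) :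
  \int[@lebesgue_measure R]_(t in `[0%R, tau]) (sin (a * t) / t) @[tau --> +oo]
  --> Num.sg a * (pi / 2).
Proof.
wlog a0 : a / 0 < a.
  move=> H; have [a0|a0|->] := ltrgt0P a; first exact: H.
    rewrite -(opprK a) sgrN mulNr.
    under eq_fun do rewrite Rintegral_sin_divN.
    by apply: cvgN; apply: H; rewrite oppr_gt0.
  rewrite sgr0 mul0r.
  under eq_fun do under eq_Rintegral do rewrite mul0r sin0 mul0r.
  under eq_fun do rewrite /Rintegral integral0/=.
  exact: cvg_cst.
rewrite gtr0_sg// mul1r.
apply/cvgrPdist_le => e e0; near=> tau.
have t0 : 0 < tau by near: tau; exact: nbhs_pinfty_gt.
rewrite distrC (le_trans (Rintegral_sin_div_pihalf _ _ _ a0 t0))//.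
rewrite ler_pdivrMr ?mulr_gt0// mulrA -ler_pdivrMl ?mulr_gt0//.
Unshelve. all: by end_near. Qed.

(** * Independence *)

Section joint_law.
Local Open Scope ereal_scope.
Context d (T : measurableType d) (R : realType) (P : probability T R).

(* The event [E] plays the role of the variables not yet peeled off: it is
   what lets independence survive the replacement of [W] by a function of [W, Y]. *)
Lemma joint_law_restr (W Y : {mfun T >-> R}) (E : set T) (q : R) :
  measurable E ->
  (forall A B : set R, measurable A -> measurable B ->
    P (W @^-1` A `&` Y @^-1` B `&` E) = P (W @^-1` A) * P (Y @^-1` B) * q%:E) ->
  forall D : set (R * R), measurable D ->
    P ((fun w => (W w, Y w)) @^-1` D `&` E) =
    (distribution P W \x distribution P Y) D * q%:E.
Proof.
move=> mE WYE D mD.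
have mWY : measurable_fun setT (fun w => (W w, Y w)) by exact: measurable_fun_pair.
pose WY : {mfun T >-> (R * R)%type} := HB.pack (fun w => (W w, Y w))
  (isMeasurableFun.Build _ _ _ _ _ mWY).
have PE : P E = q%:E.
  have := WYE setT setT measurableT measurableT.
  by rewrite !preimage_setT setTI setTI probability_setT !mul1e.
have q0 : (0 <= q)%R by rewrite -lee_fin -PE measure_ge0.
have mWD : measurable (WY @^-1` D) by exact: measurable_funPTI.
move: q0; rewrite le_eqVlt => /predU1P[q0|q0].
  rewrite -q0 mule0; apply/eqP; rewrite eq_le measure_ge0 andbT.
  have <- : P E = 0 by rewrite PE -q0.
  by apply: le_measure; rewrite ?inE//; exact: measurableI.
have qV0 : (0 <= q^-1)%R by rewrite invr_ge0 ltW.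
(* When [q > 0], [m'] is the law of the pair conditioned on [E]. It agrees with the product of the
   laws on rectangles, hence everywhere. *)
pose m' := mscale (NngNum qV0) (pushforward (mrestr P mE) WY).
have H A B : measurable A -> measurable B ->
    m' mWY (A `*` B) = distribution P W A * distribution P Y B.
  move=> mA mB; rewrite /m' /mscale /= /pushforward /mrestr/=.
  rewrite [X in P X](_ : _ = W @^-1` A `&` Y @^-1` B `&` E)//.
  by rewrite WYE// muleC -muleA -EFinM divff ?gt_eqF// mule1.
rewrite (@product_measure_unique _ _ _ _ _ (distribution P W) (distribution P Y)
  (m' mWY) H D mD).
by rewrite /m' /mscale /= /pushforward /mrestr/= muleAC -EFinM mulVf ?gt_eqF// mul1e.
Qed.

Lemma joint_law_indep (W Y : {mfun T >-> R}) :
  (forall A B : set R, measurable A -> measurable B ->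
    P (W @^-1` A `&` Y @^-1` B) = P (W @^-1` A) * P (Y @^-1` B)) ->
  forall D : set (R * R), measurable D ->
    P ((fun w => (W w, Y w)) @^-1` D) =
    (distribution P W \x distribution P Y) D.
Proof.
move=> WY D mD; rewrite -[LHS]/(P _) -[X in P X]setIT.
rewrite (joint_law_restr _ _ _ 1%R measurableT _ _ mD) ?mule1// => A B mA mB.
by rewrite setIT mule1 WY.
Qed.

End joint_law.

(** * Replacing a variable by an independent copy *)

Section decoupling.
Local Open Scope ereal_scope.
Context d (T : measurableType d) (R : realType) (P : probability T R).

(** The joint law is the product of the laws. Fubini integrates it one variable at a time, and each
    integral is then pulled back to [T], the sample point [v] providing the independent copy of
    [Y]. *)
Lemma integral_decoupling (W Y : {mfun T >-> R}) (F : R * R -> R) (M : R) :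
  (forall A B : set R, measurable A -> measurable B ->
    P (W @^-1` A `&` Y @^-1` B) = P (W @^-1` A) * P (Y @^-1` B)) ->
  measurable_fun setT F -> (forall z, `|F z| <= M)%R ->
  \int[P]_w (F (W w, Y w))%:E = \int[P]_w \int[P]_v (F (W w, Y v))%:E.
Proof.
move=> WY mF FM.
have mWY : measurable_fun setT (fun w => (W w, Y w)) by exact: measurable_fun_pair.
have mFW x : measurable_fun setT (fun y => F (x, y)).
  exact: measurableT_comp mF (pair1_measurable x).
have iF : (distribution P W \x distribution P Y).-integrable setT (EFin \o F).
  exact: (integrable_bounded_probability _ _ _ (distribution P W \x distribution P Y)%E _ M).
transitivity (\int[distribution P W \x distribution P Y]_z (F z)%:E).
  transitivity (\int[pushforward P (fun w => (W w, Y w))]_z (F z)%:E).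
    rewrite (integral_pushforward mWY)//; first exact/measurable_EFinP.
    by apply: (integrable_bounded_probability _ _ _ P (F \o (fun w => (W w, Y w))) M);
      [exact: (measurableT_comp mF mWY)|move=> z; exact: FM].
  apply: eq_measure_integral => D mD _.
  exact: joint_law_indep WY _ mD.
rewrite -(integral12_prod_meas1 iF).
have E x : fubini_F (distribution P Y) (EFin \o F) x = \int[P]_v (F (x, Y v))%:E.
  rewrite /fubini_F integral_distribution//.
    by apply/measurable_EFinP; exact: mFW.
  by apply: (integrable_bounded_probability _ _ _ P (fun v => F (x, Y v)) M);
    [exact: (measurableT_comp (mFW x))|move=> z; exact: FM].
rewrite integral_distribution//.
- by apply: eq_integral => w _; exact: E.
- exact: measurable_fubini_F iF.
have /integrableP[mG iG] := integrable_fubini_F iF.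
apply/integrableP; split; first exact: measurableT_comp mG (measurable_funPT W).
move: iG; rewrite ge0_integral_distribution//.
exact: measurableT_comp mG.
Qed.

Lemma Rintegral_decoupling (W Y : {mfun T >-> R}) (F : R * R -> R) (M : R) :
  (forall A B : set R, measurable A -> measurable B ->
    P (W @^-1` A `&` Y @^-1` B) = P (W @^-1` A) * P (Y @^-1` B)) ->
  measurable_fun setT F -> (forall z, `|F z| <= M)%R ->
  (\int[P]_w F (W w, Y w) = \int[P]_w (\int[P]_v F (W w, Y v)))%R.
Proof.
move=> WY mF FM; rewrite {1}/Rintegral (integral_decoupling _ _ _ _ WY mF FM).
congr fine; apply: eq_integral => w _; rewrite fineK//.
apply: integrable_fin_num => //.
apply: (integrable_bounded_probability _ _ _ P (fun v => F (W w, Y v)) M).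
  by apply: measurableT_comp mF _; exact: measurable_fun_pair.
by move=> z; exact: FM.
Qed.

End decoupling.

(** The law of [Y] and the uniform probability coincide on measurable sets; both integrals are
    computed through that law. *)
Lemma ge0_integral_uniform_on d (T : measurableType d) (R : realType)
    (P : probability T R) (a b : R) (Y : T -> R) (f : R -> R) :
  a < b -> uniform_on P a b Y -> measurable_fun setT f -> (forall x, 0 <= f x) ->
  (\int[P]_w (f (Y w))%:E =
   (b - a)^-1%:E * \int[@lebesgue_measure R]_(x in `[a, b]) (f x)%:E)%E.
Proof.
move=> ab [mY PY] mf f0.
(* [lebesgue_measure] lives on a measurable type whose display differs from
   that of the canonical structure on [R]. *)
have mY' : measurable_fun (U := g_sigma_algebraType R.-ocitv.-measurable) setT Y.
  exact: mY.
rewrite -(integral_uniform ab); last 2 first.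
  exact/measurable_EFinP.
  by move=> x; rewrite lee_fin.
rewrite -[LHS](@ge0_integral_pushforward _ _ _ _ _ _ mY' P setT (EFin \o f))//.
- apply: eq_measure_integral => B mB _.
  apply: (etrans (PY B mB)); rewrite /= /uniform_prob integral_uniform_pdf.
  rewrite (eq_integral (cst (b - a)^-1%:E)).
    by rewrite integral_cst//= 1?muleC//; exact: measurableI.
  by move=> x; rewrite inE => -[_ /=]; rewrite in_itv/= /uniform_pdf => ->.
- exact/measurable_EFinP.
- by move=> y _; rewrite lee_fin.
Qed.

(** Adding [M] makes [f] nonnegative; the constant contributes [M] to both sides and cancels. *)
Lemma Rintegral_uniform_on d (T : measurableType d) (R : realType)
    (P : probability T R) (a b : R) (Y : T -> R) (f : R -> R) (M : R) :
  a < b -> uniform_on P a b Y -> measurable_fun setT f -> (forall x, `|f x| <= M) ->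
  \int[P]_w (f (Y w)) = (b - a)^-1 * \int[@lebesgue_measure R]_(x in `[a, b]) (f x).
Proof.
move=> ab PY mf fM.
have mfM : measurable_fun setT (fun x => f x + M) by exact: measurable_funD.
have fM0 x : 0 <= f x + M by have := fM x; rewrite ler_norml => /andP[? _]; lra.
have := ge0_integral_uniform_on _ _ _ _ _ _ _ _ ab PY mfM fM0.
move=> /(congr1 fine); rewrite -!/(Rintegral _ _ _).
have if1 : P.-integrable setT (EFin \o (fun w => f (Y w))).
  apply: (integrable_bounded_probability _ _ _ _ _ M) => //.
  exact: measurableT_comp mf PY.1.
have if2 : (@lebesgue_measure R).-integrable `[a, b] (EFin \o f).
  apply: (@integrable_bounded _ _ _ _ _ _ M) => //.
    exact: lebesgue_measure_itvcc_fin.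
  exact: measurable_funTS.
have if2' : (@lebesgue_measure R).-integrable `[a, b] (EFin \o cst M).
  apply: (@integrable_bounded _ _ _ _ _ _ `|M|) => //.
  exact: lebesgue_measure_itvcc_fin.
rewrite fineM//; last first.
  apply: integrable_fin_num => //.
  have := integrableD _ if2 if2'.
  by apply.
rewrite [LHS]RintegralD//; last first.
  exact: (integrable_bounded_probability _ _ _ _ _ `|M|).
rewrite -/(Rintegral _ _ _) RintegralD// !Rintegral_cst//.
have -> : fine (P setT) = 1 by rewrite probability_setT.
have -> : fine (@lebesgue_measure R `[a, b]) = b - a.
  by rewrite lebesgue_measure_itv/= lte_fin ab.
have ba0 : b - a != 0 by rewrite subr_eq0 gt_eqF.
by rewrite mulr1 mulrDr/= (mulrC M) mulKf// => /addIr.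
Qed.

(** * Independence of one variable from a finite family *)

Section rect_independence.
Local Open Scope ereal_scope.
Context d (T : measurableType d) (R : realType) (P : probability T R).
Variable X : int -> {mfun T >-> R}.

(* Taking some of the [B k] to be the whole line covers every subfamily, so this
   says that [W] and the [X k], [k] in [s], are mutually independent. *)
Definition rect_indep (W : T -> R) (s : seq int) : Prop :=
  forall (A : set R) (B : int -> set R), measurable A -> (forall k, measurable (B k)) ->
    P (W @^-1` A `&` \bigcap_(k in [set k | k \in s]) (X k @^-1` B k)) =
    P (W @^-1` A) * \prod_(k <- s) P (X k @^-1` B k).

Lemma measurable_bigcap_preimage (s : seq int) (B : int -> set R) :
  (forall k, measurable (B k)) ->
  measurable (\bigcap_(k in [set k | k \in s]) (X k @^-1` B k)).
Proof.
move=> mB; apply: fin_bigcap_measurable => [|k _]; first exact: finite_seq.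
by exact: measurable_funPTI.
Qed.

(** The sets [A'] and [B] are merged into one family; since [k] is not in [s], overriding [B] at [k]
    changes none of the sets indexed by [s]. *)
Lemma rect_indep_cons (W : T -> R) (k : int) (s : seq int) :
  k \notin s -> rect_indep W (k :: s) ->
  forall (A A' : set R) (B : int -> set R), measurable A -> measurable A' ->
    (forall k, measurable (B k)) ->
    P (W @^-1` A `&` X k @^-1` A' `&` \bigcap_(m in [set m | m \in s]) (X m @^-1` B m)) =
    P (W @^-1` A) * P (X k @^-1` A') * \prod_(m <- s) P (X m @^-1` B m).
Proof.
move=> ks WI A A' B mA mA' mB.
pose B' m := if m == k then A' else B m.
have mB' m : measurable (B' m) by rewrite /B'; case: ifP.
have := WI A B' mA mB'; rewrite big_cons {2}/B' eqxx muleA.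
rewrite (eq_big_seq (fun m => P (X m @^-1` B m))); last first.
  by move=> m ms; rewrite /B' ifN//; apply: contraNneq ks => <-.
move=> <-; rewrite -setIA; congr (P (_ `&` _)); apply/seteqP; split.
  move=> w [wA wB] m /=; rewrite inE /B'; case: eqVneq => [->//|_ /= ms].
  exact: wB.
move=> w wB; split.
  by have := wB k; rewrite /B' /= eqxx mem_head; apply.
move=> m /= ms; have := wB m; rewrite /B' /= inE ms orbT ifN; first by apply.
by apply: contraNneq ks => <-.
Qed.

Lemma rect_indep2 (W : T -> R) (k : int) (s : seq int) :
  k \notin s -> rect_indep W (k :: s) ->
  forall A A' : set R, measurable A -> measurable A' ->
    P (W @^-1` A `&` X k @^-1` A') = P (W @^-1` A) * P (X k @^-1` A').
Proof.
move=> ks WI A A' mA mA'.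
have := rect_indep_cons _ _ _ ks WI A A' (fun=> setT) mA mA' (fun=> measurableT).
rewrite (_ : \bigcap_(m in _) _ = setT); last by apply/seteqP; split.
by rewrite setIT big1 ?mule1// => m _; rewrite preimage_setT probability_setT.
Qed.

(** This drives the inductions: [W] may absorb [X k] and stay independent of the remaining
    variables, whose event is the [E] of [joint_law_restr]. *)
Lemma rect_indep_comp (W : {mfun T >-> R}) (k : int) (s : seq int) (h : R * R -> R) :
  k \notin s -> measurable_fun setT h -> rect_indep W (k :: s) ->
  rect_indep (fun w => h (W w, X k w)) s.
Proof.
move=> ks mh WI A B mA mB.
have PfinE : \prod_(m <- s) P (X m @^-1` B m) = (fine (\prod_(m <- s) P (X m @^-1` B m)))%:E.
  rewrite fineK//; elim: s {ks WI} => [|m s IH]; first by rewrite big_nil.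
  by rewrite big_cons fin_numM// fin_num_measure//; exact: measurable_funPTI.
have mD : measurable (h @^-1` A) by rewrite -[X in measurable X]setTI; exact: mh.
have JE E q := @joint_law_restr _ _ _ P W (X k) E q.
have -> : (fun w => h (W w, X k w)) @^-1` A = (fun w => (W w, X k w)) @^-1` (h @^-1` A).
  by [].
rewrite (JE _ (fine (\prod_(m <- s) P (X m @^-1` B m))))//; last 2 first.
- exact: measurable_bigcap_preimage.
- by move=> A1 A2 mA1 mA2; rewrite -PfinE; exact: rect_indep_cons.
rewrite PfinE; congr (_ * _).
by rewrite -(joint_law_indep _ _ _ _ _ _ (rect_indep2 _ _ _ ks WI)).
Qed.

End rect_independence.
Arguments rect_indep {d T R} P X W s.

(** * Iterated integrals against expectations *)

Section cos_sum.
Context d (T : measurableType d) (R : realType) (P : probability T R).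
Variable X : int -> {mfun T >-> R}.
Variables (a b : R) (theta : int -> R -> R).
Hypothesis ab : a < b.
Hypothesis mtheta : forall k, measurable_fun setT (theta k).
Local Notation mu := (@lebesgue_measure R).

(** After decoupling, the addition formula separates the angle [c + W w] from [theta k], and the
    uniform law turns expectations in [X k] into integrals over the segment. *)
Lemma expectation_cosD (W : {mfun T >-> R}) (k : int) (s : seq int) (c : R) :
  k \notin s -> rect_indep P X W (k :: s) -> uniform_on P a b (X k) ->
  \int[P]_w cos (c + (W w + theta k (X k w))) =
  (b - a)^-1 * (\int[P]_w cos (c + W w) * \int[mu]_(t in `[a, b]) cos (theta k t) -
                \int[P]_w sin (c + W w) * \int[mu]_(t in `[a, b]) sin (theta k t)).
Proof.
move=> ks WI Uk.
have mcW : measurable_fun setT (fun w => cos (c + W w)).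
  by apply: measurable_cos_comp; exact: measurable_funD.
have msW : measurable_fun setT (fun w => sin (c + W w)).
  by apply: measurable_sin_comp; exact: measurable_funD.
have mctX : measurable_fun setT (fun w => cos (theta k (X k w))).
  by apply: measurable_cos_comp; exact: measurableT_comp.
have mstX : measurable_fun setT (fun w => sin (theta k (X k w))).
  by apply: measurable_sin_comp; exact: measurableT_comp.
pose F (z : R * R) := cos (c + (z.1 + theta k z.2)).
have mF : measurable_fun setT F.
  apply: measurable_cos_comp; apply: measurable_funD => //.
  by apply: measurable_funD => //; exact: measurableT_comp.
have iP (f : T -> R) : measurable_fun setT f -> (forall x, `|f x| <= 1) ->
    P.-integrable setT (EFin \o f).
  by move=> mf f1; exact: integrable_bounded_probability mf f1.
rewrite (@Rintegral_decoupling _ _ _ P W (X k) F 1 (rect_indep2 _ _ _ _ _ _ _ _ ks WI) mF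
  (fun=> cos_max _)) /F/=.
have -> : \int[P]_w (\int[P]_v cos (c + (W w + theta k (X k v)))) =
    \int[P]_w (cos (c + W w) * \int[P]_v cos (theta k (X k v)) -
                sin (c + W w) * \int[P]_v sin (theta k (X k v))).
  apply: eq_Rintegral => w _.
  rewrite -!RintegralZl//; last 2 first.
  - by apply: iP => [//|v]; exact: sin_max.
  - by apply: iP => [//|v]; exact: cos_max.
  rewrite -RintegralB//; last 2 first.
  - apply: iP => [|v]; first exact: measurable_funM.
    by rewrite normrM mulr_ile1// cos_max.
  - apply: iP => [|v]; first exact: measurable_funM.
    by rewrite normrM mulr_ile1// sin_max.
  by apply: eq_Rintegral => v _; rewrite addrA (cosD (c + W w)).
have icW := iP _ mcW (fun=> cos_max _).
have isW := iP _ msW (fun=> sin_max _).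
have iZ (f : T -> R) (r : R) : P.-integrable setT (EFin \o f) ->
    P.-integrable setT (EFin \o (fun w => f w * r)).
  move=> fi; apply: eq_integrable (integrableZl measurableT r fi) => //.
  by move=> w _ /=; rewrite -EFinM mulrC.
rewrite RintegralB//; [|exact: iZ|exact: iZ].
rewrite !RintegralZr//.
have mc : measurable_fun setT (fun t => cos (theta k t)) by exact: measurable_cos_comp.
have ms : measurable_fun setT (fun t => sin (theta k t)) by exact: measurable_sin_comp.
rewrite (Rintegral_uniform_on _ _ _ _ _ _ _ _ _ ab Uk mc (fun=> cos_max _)).
rewrite (Rintegral_uniform_on _ _ _ _ _ _ _ _ _ ab Uk ms (fun=> sin_max _)).
by ring.
Qed.

(* [C] and [S] are the real and imaginary parts of the product of the integrals of
   [exp (j theta k)].  Since [sin x = cos (x - pi / 2)], the arbitrary phase [c]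
   makes a statement about [cos] alone sufficient. *)
Lemma iint_expectation_cos (s : seq int) :
  uniq s -> (forall k, k \in s -> uniform_on P a b (X k)) ->
  exists C S : R,
    (forall (c : R) (F : (int -> R) -> R) (x : int -> R),
      (forall v, (forall m, m \notin s -> v m = x m) ->
        F v = cos (c + \sum_(m <- s) theta m (v m))) ->
      iint a b s F x = cos c * C - sin c * S) /\
    (forall (c : R) (W : {mfun T >-> R}), rect_indep P X W s ->
      \int[P]_w cos (c + (W w + \sum_(m <- s) theta m (X m w))) =
      (b - a)^-1 ^+ size s *
        (\int[P]_w cos (c + W w) * C - \int[P]_w sin (c + W w) * S)).
Proof.
elim: s => [|k s IH] /=.
  move=> _ _; exists 1, 0; split=> [c F x FE|c W _].
    by rewrite (FE x)// big_nil addr0; ring.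
  rewrite expr0 mul1r mulr1 mulr0 subr0.
  by under eq_Rintegral do rewrite big_nil addr0.
move=> /andP[ks us] Us.
have [|C [S [IH1 IH2]]] := IH us; first by move=> m ms; apply: Us; rewrite inE ms orbT.
pose Ck := \int[mu]_(t in `[a, b]) cos (theta k t).
pose Sk := \int[mu]_(t in `[a, b]) sin (theta k t).
(* Real and imaginary parts of [(Ck + j Sk) (C + j S)]. *)
exists (Ck * C - Sk * S), (Sk * C + Ck * S); split.
  move=> c F x FE; rewrite -/(Rintegral _ _ _).
  transitivity (\int[mu]_(t in `[a, b])
     ((cos c * C - sin c * S) * cos (theta k t) - (sin c * C + cos c * S) * sin (theta k t))).
    apply: eq_Rintegral => t _.
    (* The coordinate [k], frozen at [t], joins the phase; inner integrations leave it unchanged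
       because [k] is not in [s]. *)
    rewrite (IH1 (c + theta k t)); first by rewrite cosD sinD; ring.
    move=> v vE; rewrite FE.
      by rewrite big_cons addrA vE ?eqxx.
    move=> m; rewrite inE negb_or => /andP[mk ms].
    by rewrite vE// (negbTE mk).
  have iab (f : R -> R) : measurable_fun setT f -> (forall x, `|f x| <= 1) ->
      mu.-integrable `[a, b] (EFin \o f).
    move=> mf f1; apply: (@integrable_bounded _ _ _ _ _ _ 1) => //.
      exact: lebesgue_measure_itvcc_fin.
    exact: measurable_funTS.
  have iC : mu.-integrable `[a, b] (EFin \o (fun t => cos (theta k t))).
    by apply: iab => [|t]; [exact: measurable_cos_comp|exact: cos_max].
  have iS : mu.-integrable `[a, b] (EFin \o (fun t => sin (theta k t))).
    by apply: iab => [|t]; [exact: measurable_sin_comp|exact: sin_max].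
  have iZ (f : R -> R) r : mu.-integrable `[a, b] (EFin \o f) ->
      mu.-integrable `[a, b] (EFin \o (fun t => r * f t)).
    by move=> fi; apply: eq_integrable (integrableZl _ r fi).
  rewrite RintegralB//; [|exact: iZ|exact: iZ].
  rewrite !RintegralZl// -/Ck -/Sk.
  by ring.
move=> c W WI.
pose h (z : R * R) := z.1 + theta k z.2.
have mh : measurable_fun setT h by apply: measurable_funD => //; exact: measurableT_comp.
have mW' : measurable_fun setT (fun w => h (W w, X k w)).
  by apply: measurableT_comp mh _; exact: measurable_fun_pair.
pose W' : {mfun T >-> R} := HB.pack (fun w => h (W w, X k w))
  (isMeasurableFun.Build _ _ _ _ _ mW').
have Uk : uniform_on P a b (X k) by apply: Us; rewrite mem_head.
have W'I : rect_indep P X W' s by exact: rect_indep_comp ks mh WI.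
transitivity (\int[P]_w cos (c + (W' w + \sum_(m <- s) theta m (X m w)))).
  by apply: eq_Rintegral => w _; rewrite big_cons /W'/= /h/= (addrA (W w)).
rewrite (IH2 c W' W'I).
have E c' := expectation_cosD W k s c' ks WI Uk.
have -> : \int[P]_w cos (c + W' w) = (b - a)^-1 *
   (\int[P]_w cos (c + W w) * Ck - \int[P]_w sin (c + W w) * Sk) by rewrite -E.
have -> : \int[P]_w sin (c + W' w) = (b - a)^-1 *
   (\int[P]_w sin (c + W w) * Ck + \int[P]_w cos (c + W w) * Sk).
  transitivity (\int[P]_w cos (c - pi / 2 + (W w + theta k (X k w)))).
    by apply: eq_Rintegral => w _; rewrite addrAC cosBpihalf.
  rewrite E; congr (_ * _).
  have -> : \int[P]_w cos (c - pi / 2 + W w) = \int[P]_w sin (c + W w).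
    by apply: eq_Rintegral => w _; rewrite addrAC cosBpihalf.
  have -> : \int[P]_w sin (c - pi / 2 + W w) = - \int[P]_w cos (c + W w).
    rewrite -[RHS]mulN1r -RintegralZl//.
      by apply: eq_Rintegral => w _; rewrite addrAC sinBpihalf mulN1r.
    apply: (integrable_bounded_probability _ _ _ _ _ 1) => [|x]; last exact: cos_max.
    by apply: measurable_cos_comp; exact: measurable_funD.
  by rewrite mulNr opprK.
by rewrite exprS; ring.
Qed.

End cos_sum.

(** * Absence of an atom at 0 *)

Section no_atom.
Local Open Scope ereal_scope.
Context d (T : measurableType d) (R : realType) (P : probability T R).
Variable X : int -> {mfun T >-> R}.
Variables (a b : R) (g : int -> R -> R).
Hypothesis mg : forall k, measurable_fun setT (g k).
Hypothesis g_level : forall k y, countable [set x | g k x = y].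

(** Terms are absorbed into [W] until one variable, independent of [W], is left. For each value of
    [W] the zero set is then a level set of [g k], countable and so Lebesgue-null, and Fubini
    concludes. *)
Lemma sum_no_atom (k : int) (s : seq int) (W : {mfun T >-> R}) :
  uniq (k :: s) -> (forall m, m \in k :: s -> uniform_on P a b (X m)) ->
  rect_indep P X W (k :: s) ->
  P [set w | (W w + \sum_(m <- k :: s) g m (X m w))%R = 0%R] = 0.
Proof.
elim: s k W => [|m s IH] k W us Us WI; last first.
  pose h (z : R * R) : R := (z.1 + g k z.2)%R.
  have mh : measurable_fun setT h by apply: measurable_funD => //; exact: measurableT_comp.
  have mW' : measurable_fun setT (fun w => h (W w, X k w)).
    by apply: measurableT_comp mh _; exact: measurable_fun_pair.
  pose W' : {mfun T >-> R} := HB.pack (fun w => h (W w, X k w))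
    (isMeasurableFun.Build _ _ _ _ _ mW').
  case/andP: us => ks us.
  rewrite -(IH m W' us _ (rect_indep_comp _ _ _ _ _ _ _ _ _ ks mh WI)).
    congr (P _); apply/funext => w /=; congr (_ = _).
    by rewrite [LHS](congr1 (+%R (W w)) (big_cons _ _ _ _ _ _))/= addrA.
  by move=> n ns; apply: Us; rewrite inE ns orbT.
pose D := [set z : R * R | (z.1 + g k z.2)%R = 0%R].
have mh : measurable_fun setT (fun z : R * R => (z.1 + g k z.2)%R).
  by apply: measurable_funD => //; exact: measurableT_comp.
have mD : measurable D.
  by rewrite -[D]setTI; exact: mh _ (measurable_set1 0%R).
rewrite (_ : [set w | _] = (fun w => (W w, X k w)) @^-1` D); last first.
  by apply/seteqP; split=> w; rewrite /D /= big_seq1.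
rewrite (joint_law_indep _ _ _ _ _ _ (rect_indep2 _ _ _ _ _ _ _ _ _ WI))//.
rewrite /product_measure1; apply: integral0_eq => x _ /=.
have [_ UX] := Us k (mem_head _ _).
have mx : measurable (xsection D x) by exact: measurable_xsection.
rewrite /distribution /pushforward UX//.
rewrite (_ : lebesgue_measure _ = 0) ?mul0e//.
apply: countable_lebesgue_measure0.
apply: (sub_countable _ (g_level k (- x)%R)).
apply: subset_card_le => y [].
by rewrite /xsection /= inE /D/= => /eqP; rewrite addrC addr_eq0 => /eqP -> _.
Qed.

End no_atom.

(** * The Gil-Pelaez formula *)

Section gil_pelaez.
Context d (T : measurableType d) (R : realType) (P : probability T R).
Variables (Z : {mfun T >-> R}) (M : R).
Hypothesis ZM : forall w, `|Z w| <= M.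
Local Notation mu := (@lebesgue_measure R).

(** The bound on [Z] makes this kernel bounded, so Fubini applies on [[0, tau]]. *)
Let f (z : T * R) : R := sin (Z z.1 * z.2) / z.2.

Let mf : measurable_fun setT f.
Proof.
apply: measurable_funM; last first.
  by apply: measurableT_comp; [exact: measurable_invr|exact: measurable_snd].
apply: measurable_sin_comp; apply: measurable_funM; last exact: measurable_snd.
exact: measurableT_comp.
Qed.

Let fM z : `|f z| <= M.
Proof. by rewrite (le_trans (normr_sin_div_le _ _ _)). Qed.

Let P_fin : (P setT < +oo)%E.
Proof. by rewrite (le_lt_trans (probability_le1 _ _)) ?ltry. Qed.

Let expectation_sin_divE t :
  (((\int[P]_w sin (t * Z w)) / t)%:E = \int[P]_w (f (w, t))%:E)%E.
Proof.
rewrite -[RHS]fineK.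
  congr EFin; rewrite -RintegralZr//.
    by apply: eq_Rintegral => w _; rewrite /f/= (mulrC (Z w)).
  apply: (integrable_bounded_probability _ _ _ _ _ 1) => [|w]; last exact: sin_max.
  by apply: measurable_sin_comp; exact: measurable_funM.
apply: integrable_fin_num => //.
apply: (integrable_bounded_probability _ _ _ P (fun w => f (w, t)) M) => [|w]; last exact: fM.
by apply: measurableT_comp mf _; exact: measurable_fun_pair.
Qed.

Lemma integrable_expectation_sin_div (tau : R) :
  mu.-integrable `[0%R, tau] (EFin \o (fun t => (\int[P]_w sin (t * Z w)) / t)).
Proof.
have mf' : measurable_fun setT (fun z : R * T => f (z.2, z.1)).
  apply: measurableT_comp mf _.
  by apply: measurable_fun_pair; [exact: measurable_snd|exact: measurable_fst].
apply: eq_integrable (integrable_integral_bounded _ _ _ _ _ mu P `[0%R, tau]%classic setT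
  _ M (measurable_itv _) measurableT (lebesgue_measure_itvcc_fin _ _ _) P_fin mf' _) => //.
by move=> t _; rewrite /= expectation_sin_divE.
Qed.

Lemma Rintegral_expectation_sin_swap (tau : R) :
  \int[mu]_(t in `[0%R, tau]) ((\int[P]_w sin (t * Z w)) / t) =
  \int[P]_w \int[mu]_(t in `[0%R, tau]) (sin (Z w * t) / t).
Proof.
have H := @Fubini_bounded _ _ _ _ _ P mu setT `[0%R, tau]%classic f M measurableT
  (measurable_itv _) P_fin (lebesgue_measure_itvcc_fin _ _ _) mf fM.
have E2 w : ((\int[mu]_(t in `[0%R, tau]) (sin (Z w * t) / t))%:E =
    \int[mu]_(t in `[0%R, tau]) (f (w, t))%:E)%E.
  by rewrite /Rintegral fineK//; apply: integrable_fin_num => //; exact: integrable_sin_div.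
rewrite {1}/Rintegral; under eq_integral do rewrite expectation_sin_divE.
rewrite -H /Rintegral; congr fine; apply: eq_integral => w _.
by rewrite -E2.
Qed.

Hypothesis Z0 : P [set w | Z w = 0] = 0%E.

Lemma gil_pelaez :
  (fun tau : R => 2^-1 - pi^-1 * \int[mu]_(t in `[0%R, tau]) ((\int[P]_w sin (t * Z w)) / t)) x
     @[x --> +oo] --> fine (P [set w | Z w < 0]).
Proof.
pose N := [set w | Z w < 0].
have mN : measurable N.
  rewrite (_ : N = Z @^-1` `]-oo, 0[%classic); first exact: measurable_funPTI.
  by apply/seteqP; split => w; rewrite /N /= in_itv.
(* [s] equals [sgn Z * pi / 2] off the null event [Z = 0]. Written with an indicator, its
   expectation is [pi / 2 * (1 - 2 * P N)]. *)
pose s w : R := pi / 2 * (1 - 2 * \1_N w).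
have ms : measurable_fun setT s.
  by apply: measurable_funM => //; apply: measurable_funB => //; apply: measurable_funM.
have iN : P.-integrable setT (EFin \o \1_N).
  apply: (integrable_bounded_probability _ _ _ _ _ 1) => // w.
  by rewrite indicE; case: (_ \in _); rewrite ?normr1 ?normr0.
have -> : fine (P N) = 2^-1 - pi^-1 * \int[P]_w s w.
  have i1 : P.-integrable setT (EFin \o cst (1:R)).
    by apply: (integrable_bounded_probability _ _ _ _ _ 1) => // w; rewrite normr1.
  have iN2 : P.-integrable setT (EFin \o (fun w => 2 * \1_N w : R)).
    exact: eq_integrable (integrableZl _ 2 iN).
  rewrite RintegralZl//; last exact: eq_integrable (integrableB _ i1 iN2).
  rewrite RintegralB// RintegralZl// Rintegral_cst//.
  have -> : fine (P setT) = 1 by rewrite probability_setT.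
  rewrite /Rintegral integral_indic// setIT.
  have p0 : pi != 0 :> R by rewrite gt_eqF// pi_gt0.
  by rewrite -(mulrA pi) mulKf//; lra.
apply: cvgB; first exact: cvg_cst.
apply: cvgM; first exact: cvg_cst.
(* Dominated convergence concerns sequences, so the limit is tested along an arbitrary sequence
   tending to infinity. *)
apply/cvg_pinftyP => u uy.
under eq_fun do rewrite Rintegral_expectation_sin_swap.
have is_ : P.-integrable setT (EFin \o s).
  apply: (integrable_bounded_probability _ _ _ _ _ (pi / 2)) => // w.
  rewrite normrM ger0_norm ?divr_ge0 ?pi_ge0// ler_piMr ?divr_ge0 ?pi_ge0// /s indicE.
  by case: (_ \in _); rewrite /= ?mulr0 ?mulr1 ler_norml; apply/andP; split; lra.
apply: fine_cvg.
rewrite /Rintegral fineK; last exact: integrable_fin_num.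
have [|||||_ _] := @dominated_convergence _ _ _ P setT measurableT
   (fun n w => (\int[mu]_(t in `[0%R, u n]) (sin (Z w * t) / t))%:E) (EFin \o s)
   (cst (5 : R)%:E).
- move=> n.
  have := measurable_int _ (integrable_integral_bounded _ _ _ _ _ P mu setT `[0, u n]%classic
    f M measurableT (measurable_itv _) P_fin (lebesgue_measure_itvcc_fin _ _ _) mf fM).
  apply: eq_measurable_fun => w _; rewrite /Rintegral fineK//.
  by apply: integrable_fin_num => //; exact: integrable_sin_div.
- exact/measurable_EFinP.
(* Where [Z] vanishes the integrals are 0 while [s] is [pi / 2]; this is where the absence of an
   atom enters. *)
- exists [set w | Z w = 0]; split => //.
    by rewrite (_ : [set _ | _] = Z @^-1` [set 0])//; exact: measurable_funPTI.
  move=> w /= /not_implyP[_ nc]; apply: contrapT => /eqP Zw0; apply: nc.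
  apply: cvg_EFin; first exact: nearW.
  have -> : s w = Num.sg (Z w) * (pi / 2).
    rewrite /s indicE mulrC; congr (_ * _).
    have [Zw|Zw|/eqP] := ltrgt0P (Z w); last by rewrite (negbTE Zw0).
      by rewrite gtr0_sg// memNset ?mulr0 ?subr0// /N /= => /lt_trans - /(_ _ Zw);
        rewrite ltxx.
    by rewrite ltr0_sg// mem_set//= mulr1; lra.
  exact: (@cvg_pinftyP R _ _).1 (cvg_Rintegral_sin_div _ (Z w)) u uy.
- by apply: (integrable_bounded_probability _ _ _ _ _ 5) => // w; rewrite ger0_norm.
- by apply: aeW => w n _; rewrite /= lee_fin Rintegral_sin_div_bounded.
by move=> H; apply: cvg_trans H.
Qed.

End gil_pelaez.

(** * The interference model *)

(** Inversion is an involution, also at 0, so the equation reads [(x - xi) ^+ 2 = y^-1 - q] and has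
    at most two roots. *)
Lemma countable_inv_sqr_level (R : realType) (xi q y : R) :
  countable [set x : R | ((x - xi) ^+ 2 + q)^-1 = y].
Proof.
apply: finite_set_countable.
apply: (@sub_finite_set _ _ [set xi + Num.sqrt (y^-1 - q); xi - Num.sqrt (y^-1 - q)]);
  last exact: finite_set2.
move=> x /= xy; have -> : y^-1 - q = (x - xi) ^+ 2 by rewrite -xy invrK addrK.
rewrite sqrtr_sqr; have [_|_] := ger0P (x - xi); [left|right]; ring.
Qed.

Lemma idxK_uniq (K : nat) : uniq (idxK K).
Proof. by rewrite map_inj_uniq ?iota_uniq// => m n /addIr; case. Qed.

Lemma idxKi_uniq (K : nat) (i : int) : uniq (idxKi K i).
Proof. exact/filter_uniq/idxK_uniq. Qed.

Lemma size_idxKi (K : nat) (i : int) : - K%:Z <= i <= K%:Z ->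
  size (idxKi K i) = (2 * K)%N.
Proof.
move=> iK; rewrite -[RHS]/(2 * K).+1.-1.
have <- : size (idxK K) = (2 * K).+1 by rewrite size_map size_iota.
have iin : i \in idxK K.
  apply/mapP; exists (absz (i + K%:Z)); first by rewrite mem_iota; lia.
  by lia.
by rewrite /idxKi -rem_filter ?idxK_uniq// size_rem.
Qed.

(** Starting point of the inductions: the preimages of a constant are empty or everything, so it is
    independent of any family. *)
Lemma mutually_independent_rect_indep d (T : measurableType d) (R : realType)
    (P : probability T R) (X : int -> T -> R) (X' : int -> {mfun T >-> R})
    (s : seq int) (c : R) :
  uniq s -> (forall k, k \in s -> X' k = X k :> (T -> R)) ->
  mutually_independent P s X -> rect_indep P X' (cst c) s.
Proof.
move=> us XE XI A B mA mB.
have E : P (\bigcap_(k in [set k | k \in s]) (X' k @^-1` B k)) =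
    (\prod_(k <- s) P (X' k @^-1` B k))%E.
  rewrite (eq_big_seq (fun k => P (X k @^-1` B k))); last first.
    by move=> k ks; rewrite XE.
  rewrite -(XI s us (fun=> id) B mB); congr (P _).
  by apply: eq_bigcapr => k /= ks; rewrite XE.
rewrite -E; have [cA|cA] := pselect (A c).
  have -> : cst c @^-1` A = [set: T] by apply/seteqP; split.
  by rewrite setTI probability_setT mul1e.
have -> : cst c @^-1` A = @set0 T by apply/seteqP; split.
by rewrite set0I measure0 mul0e.
Qed.

(** The outer integral is improper and is expressed as a limit in [tau]; at the single point [t = 0]
    its integrand takes the value 0. *)
Theorem theorem1 (R : realType) (K : nat) (i : int)
  (L h d eta Pt sigma2 gamma0 xi yi : R)
  (dT : measure_display) (T : measurableType dT) (P : probability T R)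
  (X : int -> T -> R) :
  (1 <= K)%N ->
  - (K%:Z) <= i <= K%:Z ->
  0 < L -> 0 < h -> 0 < d -> 0 < eta -> 0 < Pt -> 0 < sigma2 -> 0 < gamma0 ->
  - (L / 2) <= xi <= L / 2 ->
  i%:~R * d - d / 2 <= yi <= i%:~R * d + d / 2 ->
  (forall k, k \in idxKi K i -> uniform_on P (- (L / 2)) (L / 2) (X k)) ->
  mutually_independent P (idxKi K i) X ->
  (fun tau : R =>
     2^-1 - pi^-1 * (L^-1) ^+ (2 * K) *
       fine (\int[@lebesgue_measure R]_(t in `[0%R, tau])
         (complex.Im (ciint (- (L / 2)) (L / 2) (idxKi K i)
             (fun v => expj (t * Aq K i d h eta Pt sigma2 gamma0 xi yi v))
             (fun _ => 0)) / t)%:E)%E)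
    x @[x --> +oo]
  --> fine (P [set w | sinr K i d h eta Pt sigma2 xi yi (fun k => X k w) > gamma0]).
Proof.
move=> K1 iK L0 h0 d0 eta0 Pt0 s0 g0 xiL yiL Us XI.
set s := idxKi K i in Us XI *.
have us : uniq s := idxKi_uniq K i.
have ss : size s = (2 * K)%N := size_idxKi K i iK.
pose g (k : int) (x : R) : R := ((x - xi) ^+ 2 + ((k%:~R * d - yi) ^+ 2 + h ^+ 2))^-1.
have mg k : measurable_fun setT (g k).
  apply: measurableT_comp; first exact: measurable_invr.
  by apply: measurable_funD => //; apply: measurable_funX; exact: measurable_funB.
have h20 : 0 < h ^+ 2 by rewrite exprn_gt0.
have g_ge0 k x : 0 <= g k x by rewrite invr_ge0 !addr_ge0 ?sqr_ge0.
have g_le k x : g k x <= (h ^+ 2)^-1.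
  rewrite lef_pV2 ?posrE//; first by rewrite addrA lerDr addr_ge0 ?sqr_ge0.
  by rewrite addrA ltr_wpDl// addr_ge0 ?sqr_ge0.
(* Measurability of [X k] is known only for [k] in [s]; elsewhere it is replaced by a constant. *)
have mX k : measurable_fun setT (if k \in s then X k else cst 0).
  by case: ifP => // /Us[].
pose X' k : {mfun T >-> R} := HB.pack (if k \in s then X k else cst 0)
  (isMeasurableFun.Build _ _ _ _ _ (mX k)).
have X'E k : k \in s -> X' k = X k :> (T -> R) by rewrite /X' /= => ->.
have Us' k : k \in s -> uniform_on P (- (L / 2)) (L / 2) (X' k).
  by move=> ks; rewrite X'E//; exact: Us.
pose c0 := sigma2 / (eta * Pt) - (r0 d h i yi)^-1 / (eta * gamma0).
have AqE x : Aq K i d h eta Pt sigma2 gamma0 xi yi x = c0 + \sum_(k <- s) g k (x k).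
  rewrite /Aq addrAC; congr (_ + _); apply: eq_bigr => k _.
  by rewrite /g /rk addrA.
have mZ : measurable_fun setT (fun w => c0 + \sum_(k <- s) g k (X' k w)).
  apply: measurable_funD => //; apply: measurable_sum => k.
  exact: measurableT_comp.
pose Z : {mfun T >-> R} := HB.pack (fun w => c0 + \sum_(k <- s) g k (X' k w))
  (isMeasurableFun.Build _ _ _ _ _ mZ).
have LE : L / 2 - - (L / 2) = L by field.
have ab : - (L / 2) < L / 2 by rewrite -subr_gt0 LE.
have X'I c : rect_indep P X' (cst c) s by exact: mutually_independent_rect_indep XI.
have ZM w : `|Z w| <= `|c0| + (h ^+ 2)^-1 *+ size s.
  rewrite (le_trans (ler_normD _ _))// lerD2l ger0_norm ?sumr_ge0//.
  by rewrite (le_trans (ler_sum _ (fun k _ => g_le k _)))// big_const_seq count_predT iter_addr_0.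
have Z0 : P [set w | Z w = 0] = 0%E.
  (* Since [1 <= K], at least one random term is present; the constant [c0] alone could vanish. *)
  have : s != [::] by rewrite -size_eq0 ss muln_eq0/= -lt0n.
  case sE : s => [//|k s'] _.
  have := @sum_no_atom _ _ _ P X' (- (L / 2)) (L / 2) g mg _ k s' (cst c0).
  rewrite -sE; apply => //; last exact: X'I.
  by move=> m y; exact: countable_inv_sqr_level.
have EI t : complex.Im (ciint (- (L / 2)) (L / 2) s
     (fun v => expj (t * Aq K i d h eta Pt sigma2 gamma0 xi yi v)) (fun=> 0)) =
   L ^+ (2 * K) * \int[P]_w sin (t * Z w).
  have mth k : measurable_fun setT (fun x => t * g k x) by exact: measurable_funM.
  have [C [S [H1 H2]]] := iint_expectation_cos _ _ _ P X' _ _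
    (fun k x => t * g k x) ab mth s us Us'.
  have E1 u : sin (t * (c0 + \sum_(k <- s) g k (u k))) =
      cos (t * c0 - pi / 2 + \sum_(k <- s) t * g k (u k)).
    by rewrite mulrDr mulr_sumr [in RHS]addrAC cosBpihalf.
  rewrite /= (H1 (t * c0 - pi / 2)); last by move=> v _; rewrite AqE E1.
  have -> : \int[P]_w sin (t * Z w) =
      \int[P]_w cos (t * c0 - pi / 2 + (cst 0 w + \sum_(k <- s) t * g k (X' k w))).
    by apply: eq_Rintegral => w _; rewrite /Z /= add0r (E1 (fun k => X' k w)).
  rewrite H2; last exact: X'I.
  (* The segment has length [L], so the [2 * K] uniform densities contribute [L^-1 ^+ (2 * K)],
     cancelled by the prefactor. *)
  rewrite LE ss exprVn mulVKf ?expf_neq0 ?gt_eqF//.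
  have PT : fine (P setT) = 1 by rewrite probability_setT.
  have := Rintegral_cst P measurableT (cos (t * c0 - pi / 2 + 0)).
  have := Rintegral_cst P measurableT (sin (t * c0 - pi / 2 + 0)).
  by rewrite PT !mulr1 addr0 /= => -> ->.
have -> : [set w | sinr K i d h eta Pt sigma2 xi yi (fun k => X k w) > gamma0] =
    [set w | Z w < 0].
  apply/funext => w /=; apply/propext.
  rewrite /sinr -/s.
  pose S := \sum_(k <- s) g k (X' k w).
  have S0 : 0 <= S by apply: sumr_ge0.
  have -> : \sum_(k <- s) (rk d h xi yi (fun k => X k w) k)^-1 = S.
    by apply: eq_big_seq => k ks; rewrite X'E// /g /rk addrA.
  (* Clearing the positive denominator of the SINR turns success into
     [(c0 + S) * (eta * gamma0) < 0]. *)
  rewrite ltr_pdivlMr; last by rewrite ltr_wpDl ?divr_gt0// mulr_ge0// ltW.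
  rewrite -/S -(pmulr_llt0 _ (mulr_gt0 eta0 g0)) -[X in is_true X <-> _]subr_lt0.
  rewrite (_ : _ - _ = (c0 + S) * (eta * gamma0))//.
  by rewrite /c0; move: (r0 _ _ _ _)^-1 => q; field; rewrite !gt_eqF.
have := gil_pelaez _ _ _ P Z _ ZM Z0.
apply: cvg_trans; apply: near_eq_cvg; apply: nearW => tau.
rewrite -mulrA; congr (_ - _ * _).
rewrite -/(Rintegral _ _ _).
under [in RHS]eq_Rintegral do rewrite EI -mulrA.
rewrite RintegralZl//; last exact: integrable_expectation_sin_div ZM tau.
by rewrite mulrA -exprMn mulVf ?gt_eqF// expr1n mul1r.
Qed.
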